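(* Assume that all of the following hold. (i) There exist $\alpha_{\mathrm{lo}}^T,\alpha_{\mathrm{up}}^T\in\mathcal{K}_\infty$ such that $\alpha_{\mathrm{lo}}^T(|r|_{r_{\mathrm d}})\le T(r)\le \alpha_{\mathrm{up}}^T(|r|_{r_{\mathrm d}})$ for all $r\in\mathcal{R}$. (ii) There exist $c_1^\ell,c_2^\ell>0$ such that $c_1^\ell|x|_{x_r}^2\le\bar\ell(x,r)\le c_2^\ell|x|_{x_r}^2$ for all $(x,u)\in\mathcal{Z}$ and $r=(x_r,u_r)\in\mathcal{R}$. (iii) There exist $c_3^\ell,c_4^\ell>0$ such that $\ell(x,u,r_1)\le c_3^\ell\,\ell(x,u,r_2)+c_4^\ell|r_1|_{r_2}^2$ for all $r_1,r_2\in\mathcal{R}$, $(x,u)\in\mathcal{Z}$. (iv) $c_5^\ell,c_6^\ell>0$ are constants such that $\ell(x,u,r_1)\le \ell(x,u,r_2)+c_5^\ell|r_1|_{r_2}^2+c_6^\ell|r_1|_{r_2}$ for all $r_1,r_2\in\mathcal{R}$, $(x,u)\in\mathcal{Z}$. (v) There exist $c_{\mathrm b},c_{\mathrm f}>0$ and a map $k_{\mathrm f}:X\times\mathcal{R}\to\mathbb{R}^m$ such that the terminal cost $V^{\mathrm f}$ is continuous, the terminal sets $\mathcal{X}^{\mathrm f}(r)\subseteq X$ are compact, and for any $r=(x_r,u_r)\in\mathcal{R}$ and any $x\in\mathcal{X}^{\mathrm f}(r)$, with $x^+=f(x,k_{\mathrm f}(x,r))$: $x^+\in\mathcal{X}^{\mathrm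 f}(r)$; $V^{\mathrm f}(x^+,r)-V^{\mathrm f}(x,r)\le-\ell(x,k_{\mathrm f}(x,r),r)$; $(x,k_{\mathrm f}(x,r))\in\mathcal{Z}$; $\mathcal{B}_{c_{\mathrm b}}(x_r)\subseteq\mathcal{X}^{\mathrm f}(r)$; $V^{\mathrm f}(x,r)\le c_{\mathrm f}\bar\ell(x,r)$. (vi) $\lambda(N)\ge N$ for all $N\in\mathbb{N}_0$ and $\lambda(0)\ge1$. (vii) There exist $c_1^{\mathrm r},c_2^{\mathrm r}>0$ such that for any $r\in\mathcal{R}$ and any $\theta\in[0,1]$ there exists $\hat r\in\mathcal{R}$ with $|\hat r|_r\le c_1^{\mathrm r}\theta|r|_{r_{\mathrm d}}$ and $T(\hat r)-T(r)\le-c_2^{\mathrm r}\theta|r|_{r_{\mathrm d}}^2$. Then, for any $\widetilde N\in\mathbb{N}_0$, there exist $\delta_1,\delta_2\in\mathcal{L}$ and $\bar N\in\mathbb{N}$ such that for all $x\in\mathcal{X}_{\widetilde N}$, $N\ge\bar N$ and $K\in\mathbb{N}_0$, writing $x_{\mu_N}(k)=x_{\mu_N}(k,x)$, $$J_K^{\mathrm d}(x,\mu_N)=\sum_{k=0}^{K-1}\ell\big(x_{\mu_N}(k),\mu_N(x_{\mu_N}(k)),r_{\mathrm d}\big)\le\inf_{u\in\mathbb{U}^K_{\mathcal{B}_\kappa(x_{\mathrm d})}(x)}J_K^{\mathrm d}(x,u)+\delta_1(N)+\delta_2(K)-V_N(x_{\mu_N}(K))+\sum_{k=0}^{K-1}\Big(c_5^\ell|r_N^*(x_{\mu_N}(k))|_{r_{\mathrm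 d}}^2+c_6^\ell|r_N^*(x_{\mu_N}(k))|_{r_{\mathrm d}}\Big),$$ where $\kappa=c_{\mathrm{std}}|x|_{x_{\mathrm d}}\gamma_{\mathrm{std}}^K$, with $c_{\mathrm{std}}>0$, $\gamma_{\mathrm{std}}\in(0,1)$ the exponential-stability constants of the standard MPC closed loop.
   Context: Notation. $\mathbb{N}$ are the positive integers, $\mathbb{N}_0=\mathbb{N}\cup\{0\}$, $\mathbb{I}_{a:b}$ the integers from $a$ to $b$. For vectors, $|v|_{v'}=\|v-v'\|_2$ (Euclidean distance). $\mathcal{B}_c(\tilde x)=\{x\in\mathbb{R}^n\mid\|x-\tilde x\|_2\le c\}$. $\mathcal{K}_\infty$: continuous, strictly increasing, unbounded functions $\alpha:\mathbb{R}_{\ge0}\to\mathbb{R}_{\ge0}$ with $\alpha(0)=0$. $\mathcal{L}$: continuous, strictly decreasing functions $\mathbb{R}_{\ge0}\to\mathbb{R}_{\ge0}$ with limit $0$ at infinity. System. $x(t+1)=f(x(t),u(t))$ with $f:\mathbb{R}^n\times\mathbb{R}^m\to\mathbb{R}^n$ continuous, $x(t)\in X\subset\mathbb{R}^n$ bounded, $u(t)\in U\subset\mathbb{R}^m$ compact, and constraints $(x(t),u(t))\in\mathcal{Z}$ with $\mathcal{Z}\subseteq X\times U$ compact. For $x\in X$ and $u\in U^K$, $x_u(k,x)$ is the solution: $x_u(0,x)=x$, $x_u(k+1,x)=f(x_u(k,x),u(k))$. The sequence $u\in U^K$ is admissible if $(x_u(k,x),u(k))\in\mathcal{Z}$ for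 all $k\in\mathbb{I}_{0:K-1}$ and $x_u(K,x)\in X$. For a closed set $\mathbb{X}$, $\mathbb{U}^K_{\mathbb{X}}(x)$ is the set of admissible $u\in U^K$ with $x_u(K,x)\in\mathbb{X}$. The infimum over the empty set is $+\infty$. References. $\mathcal{Z}_{\mathrm r}\subseteq\mathrm{int}\,\mathcal{Z}$ is closed and $\mathcal{R}=\{(x,u)\in\mathcal{Z}_{\mathrm r}\mid x=f(x,u)\}$. For $r=(x_r,u_r),\hat r=(x_{\hat r},u_{\hat r})\in\mathcal{R}$, $|r|_{\hat r}=\sqrt{|x_r|_{x_{\hat r}}^2+|u_r|_{u_{\hat r}}^2}$. $T$ is a real-valued offset cost (attaining its overall minimum at an external reference $r_{\mathrm e}$, possibly not in $\mathcal{R}$). The best reachable reference $r_{\mathrm d}=(x_{\mathrm d},u_{\mathrm d})=\arg\min_{r\in\mathcal{R}}T(r)$ is assumed unique, with $T(r_{\mathrm d})=0$. Costs. $\ell:X\times U\times\mathcal{R}\to\mathbb{R}_{\ge0}$ is the stage cost, $\bar\ell(x,r)=\min_{u\in U,\,(x,u)\in\mathcal{Z}}\ell(x,u,r)$, $V^{\mathrm f}:X\times\mathcal{R}\to\mathbb{R}_{\ge0}$ the terminal cost, $\mathcal{X}^{\mathrm f}(r)\subseteq X$ ($r\in\mathcal{R}$) the terminal sets, $\lambda:\mathbb{N}_0\to\mathbb{R}_{\ge0}$ the scaling function. $J_N^{\mathrm{tc}}(x,u,r)=\sum_{k=0}^{N-1}\ell(x_u(k,x),u(k),r)+V^{\mathrm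 f}(x_u(N,x),r)$ and $J_K^{\mathrm d}(x,u)=\sum_{k=0}^{K-1}\ell(x_u(k,x),u(k),r_{\mathrm d})$. MPC for tracking with horizon $N$: $V_N(x)=\min\{J_N^{\mathrm{tc}}(x,u,r)+\lambda(N)T(r)\mid r\in\mathcal{R},\,u\in\mathbb{U}^N_{\mathcal{X}^{\mathrm f}(r)}(x)\}$; $\mathcal{X}_N$ is the set of states for which this problem is feasible; $(u_N^*,r_N^*(x))$ denotes its optimal solution (minimisers are taken to exist whenever the problem is feasible); $\mu_N(x)=u_N^*(0)$ is the first element of the optimal input sequence; $x_{\mu_N}(k,x)$ is the solution of the closed loop $x(t+1)=f(x(t),\mu_N(x(t)))$ with $x(0)=x$. Standard MPC with horizon $N$: $W_N(x)=\min_{u\in\mathbb{U}^N_{\mathcal{X}^{\mathrm f}(r_{\mathrm d})}(x)}J_N^{\mathrm{tc}}(x,u,r_{\mathrm d})$, feasible on the set $\mathcal{X}_N^{\mathrm{std}}$; $\nu_N(x)$ is the first element of its optimal input sequence, and $x_{\nu_N}(t,x)$ is the solution of $x(t+1)=f(x(t),\nu_N(x(t)))$, $x(0)=x$. It is known that under (ii) and (v) the point $x_{\mathrm d}$ is exponentially stable for this closed loop, and $c_{\mathrm{std}}>0$, $\gamma_{\mathrm{std}}\in(0,1)$ denote corresponding constants, i.e. $|x_{\nu_N}(t,x)|_{x_{\mathrm d}}\le c_{\mathrm{std}}|x|_{x_{\mathrm d}}\gamma_{\mathrm{std}}^t$ for all $t\in\mathbb{N}_0$ and $x\in\mathcal{X}_N^{\mathrm{std}}$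 (these constants may depend on $N$).
   Formalization: The stage cost ℓ is additionally assumed bounded on Z×R (implied by continuity of ℓ); without this the claim can fail already at K=0. In (v), B_{c_b}(x_r) ⊆ X^f(r) is required for every r in R, so no terminal set is empty. *)

(* Defs.v *)
From HB Require Import structures.
From mathcomp Require Import all_boot all_order all_algebra.
From mathcomp Require Import all_classical all_reals all_analysis.

Set Implicit Arguments.
Unset Strict Implicit.
Unset Printing Implicit Defensive.

Import Order.TTheory GRing.Theory Num.Theory.
Import numFieldNormedType.Exports.

Local Open Scope classical_set_scope.
Local Open Scope ring_scope.

(* The library norm on matrices is the sup norm; the Euclidean one is set up
   here.  The topology on 'rV[R]_n is the same. *)
Definition eucl_norm (R : realType) (n : nat) (v : 'rV[R]_n) : R :=
  Num.sqrt (\sum_i v 0 i ^+ 2).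

Definition eucl_dist (R : realType) (n : nat) (v w : 'rV[R]_n) : R := eucl_norm (v - w).

Definition eucl_ball (R : realType) (n : nat) (c : R) (v : 'rV[R]_n) :
  set 'rV[R]_n := [set x | eucl_dist x v <= c].

Definition reference (R : realType) (n m : nat) := ('rV[R]_n * 'rV[R]_m)%type.

Definition ref_dist (R : realType) (n m : nat) (r s : reference R n m) : R :=
  Num.sqrt (eucl_dist r.1 s.1 ^+ 2 + eucl_dist r.2 s.2 ^+ 2).

(* Functions R_{>=0} -> R_{>=0} are represented by functions R -> R of which
   only the values on [0, +oo[ matter. *)
Record class_Kinfty (R : realType) (a : R -> R) : Prop := {
  Kinfty_cts : {within `[0, +oo[, continuous a};
  Kinfty_incr : forall s t, 0 <= s -> s < t -> a s < a t;
  Kinfty_ge0 : forall t, 0 <= t -> 0 <= a t;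
  Kinfty_unbounded : forall M : R, exists2 t, 0 <= t & M < a t;
  Kinfty0 : a 0 = 0
}.

Record class_L (R : realType) (d : R -> R) : Prop := {
  L_cts : {within `[0, +oo[, continuous d};
  L_decr : forall s t, 0 <= s -> s < t -> d t < d s;
  L_ge0 : forall t, 0 <= t -> 0 <= d t;
  L_lim : d t @[t --> +oo] --> (0 : R)
}.

(* The functions are total; only their values on the domains appearing in
   [standing_assumptions] matter. *)
Record mpc_problem (R : realType) (n m : nat) := MPCProblem {
  dyn : 'rV[R]_n -> 'rV[R]_m -> 'rV[R]_n;                (* f *)
  Xset : set 'rV[R]_n;                                   (* X *)
  Uset : set 'rV[R]_m;                                   (* U *)
  Zset : set ('rV[R]_n * 'rV[R]_m);                      (* Z *)
  Zref : set (reference R n m);                          (* Z_r *)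
  stage : 'rV[R]_n -> 'rV[R]_m -> reference R n m -> R;  (* ell *)
  Vterm : 'rV[R]_n -> reference R n m -> R;              (* V^f *)
  Xterm : reference R n m -> set 'rV[R]_n;               (* X^f *)
  offset : reference R n m -> R;                         (* T *)
  scaling : nat -> R                                     (* lambda *)
}.

Definition refs (R : realType) (n m : nat) (P : mpc_problem R n m) :
  set (reference R n m) :=
  [set r | Zref P r /\ r.1 = dyn P r.1 r.2].

(* Equal to the minimum, whose attainment is part of
   [standing_assumptions]. *)
Definition stage_min (R : realType) (n m : nat) (P : mpc_problem R n m)
  (x : 'rV[R]_n) (r : reference R n m) : R :=
  inf [set stage P x u r | u in [set u | Uset P u /\ Zset P (x, u)]].

Record standing_assumptions (R : realType) (n m : nat)
  (P : mpc_problem R n m) (rd : reference R n m) : Prop := {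
  dyn_cts : continuous (fun p : 'rV[R]_n * 'rV[R]_m => dyn P p.1 p.2);
  Xset_bounded : exists M : R, forall x, Xset P x -> eucl_norm x <= M;
  Uset_compact : compact (Uset P);
  Zset_sub : Zset P `<=` Xset P `*` Uset P;
  Zset_compact : compact (Zset P);
  Zref_sub : Zref P `<=` interior (Zset P);
  Zref_closed : closed (Zref P);
  stage_ge0 : forall x u r, Xset P x -> Uset P u -> refs P r ->
    0 <= stage P x u r;
  (* follows from continuity of the stage cost, [Zset P] and [refs P] being
     compact *)
  stage_bounded : exists M : R, forall x u r, Zset P (x, u) -> refs P r ->
    stage P x u r <= M;
  stage_min_attained : forall x r, refs P r -> (exists u, Zset P (x, u)) ->
    exists2 u, Uset P u /\ Zset P (x, u) &
      forall u', Uset P u' -> Zset P (x, u') -> stage P x u r <= stage P x u' r;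
  Vterm_ge0 : forall x r, Xset P x -> refs P r -> 0 <= Vterm P x r;
  Xterm_sub : forall r, refs P r -> Xterm P r `<=` Xset P;
  offset_min : exists re, forall r, offset P re <= offset P r;
  rd_ref : refs P rd;
  rd_argmin : forall r, refs P r -> offset P rd <= offset P r;
  rd_unique : forall r, refs P r ->
    (forall s, refs P s -> offset P r <= offset P s) -> r = rd;
  rd_offset : offset P rd = 0;
  scaling_ge0 : forall N, 0 <= scaling P N
}.

Fixpoint solution (R : realType) (n m : nat) (P : mpc_problem R n m)
  (u : nat -> 'rV[R]_m) (x : 'rV[R]_n) (k : nat) : 'rV[R]_n :=
  if k is j.+1 then dyn P (solution P u x j) (u j) else x.

(* An input sequence in U^K is represented by u : nat -> 'rV[R]_m, of which
   only u 0, ..., u (K - 1) matter. *)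
Definition admissible (R : realType) (n m : nat) (P : mpc_problem R n m)
  (K : nat) (x : 'rV[R]_n) (u : nat -> 'rV[R]_m) : Prop :=
  [/\ forall k, (k < K)%N -> Uset P (u k),
      forall k, (k < K)%N -> Zset P (solution P u x k, u k) &
      Xset P (solution P u x K)].

Definition admissible_to (R : realType) (n m : nat) (P : mpc_problem R n m)
  (K : nat) (A : set 'rV[R]_n) (x : 'rV[R]_n) : set (nat -> 'rV[R]_m) :=
  [set u | admissible P K x u /\ A (solution P u x K)].

(* J^d_K(x, u) is [run_cost P rd K x u]. *)
Definition run_cost (R : realType) (n m : nat) (P : mpc_problem R n m)
  (r : reference R n m) (K : nat) (x : 'rV[R]_n) (u : nat -> 'rV[R]_m) : R :=
  \sum_(0 <= k < K) stage P (solution P u x k) (u k) r.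

Definition Jtc (R : realType) (n m : nat) (P : mpc_problem R n m)
  (N : nat) (x : 'rV[R]_n) (u : nat -> 'rV[R]_m) (r : reference R n m) : R :=
  run_cost P r N x u + Vterm P (solution P u x N) r.

Definition track_candidates (R : realType) (n m : nat) (P : mpc_problem R n m)
  (N : nat) (x : 'rV[R]_n) : set ((nat -> 'rV[R]_m) * reference R n m) :=
  [set ur | refs P ur.2 /\ admissible_to P N (Xterm P ur.2) x ur.1].

Definition track_cost (R : realType) (n m : nat) (P : mpc_problem R n m)
  (N : nat) (x : 'rV[R]_n) (ur : (nat -> 'rV[R]_m) * reference R n m) : R :=
  Jtc P N x ur.1 ur.2 + scaling P N * offset P ur.2.

Definition XN (R : realType) (n m : nat) (P : mpc_problem R n m) (N : nat) :
  set 'rV[R]_n := [set x | track_candidates P N x !=set0].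

(* Extended-real valued: +oo outside [XN P N]. *)
Definition VN (R : realType) (n m : nat) (P : mpc_problem R n m)
  (N : nat) (x : 'rV[R]_n) : \bar R :=
  ereal_inf [set (track_cost P N x ur)%:E | ur in track_candidates P N x].

Definition track_optimal (R : realType) (n m : nat) (P : mpc_problem R n m)
  (N : nat) (x : 'rV[R]_n) (ur : (nat -> 'rV[R]_m) * reference R n m) : Prop :=
  track_candidates P N x ur /\
  forall ur', track_candidates P N x ur' ->
    track_cost P N x ur <= track_cost P N x ur'.

Definition XNstd (R : realType) (n m : nat) (P : mpc_problem R n m)
  (rd : reference R n m) (N : nat) : set 'rV[R]_n :=
  [set x | admissible_to P N (Xterm P rd) x !=set0].

Definition std_optimal (R : realType) (n m : nat) (P : mpc_problem R n m)
  (rd : reference R n m) (N : nat) (x : 'rV[R]_n) (u : nat -> 'rV[R]_m) :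
  Prop :=
  admissible_to P N (Xterm P rd) x u /\
  forall u', admissible_to P N (Xterm P rd) x u' ->
    Jtc P N x u rd <= Jtc P N x u' rd.

Definition closed_loop (R : realType) (n m : nat) (P : mpc_problem R n m)
  (mu : 'rV[R]_n -> 'rV[R]_m) (x : 'rV[R]_n) (k : nat) : 'rV[R]_n :=
  iter k (fun y => dyn P y (mu y)) x.

(* Main.v *)
(** Along the closed loop, shifting the optimal input and appending the terminal
    law while keeping the same reference shows that V_N decreases by the current
    stage cost; summing, and passing from the optimal references to r_d with
    (iv), reduces the claim to V_N(x) <= J_K^d(x, u) + delta_1(N) + delta_2(K)
    for every admissible u.

    Every state of X_Ntilde can be steered to the terminal set of r_d in a
    uniform number of steps: the terminal law brings the state close to x_r,
    after which r can be moved towards r_d by (vii), and each such move lowers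
    the bounded offset cost by a fixed amount.  Hence V_N <= C uniformly.

    Now let L = min(N, K) and J_K^d(x, u) <= C.  Some stage cost among the first
    L is at most C / L, so for large L that state lies in the terminal set of
    r_d, and switching to the terminal law there costs at most c_f C / L. *)

Require Import Defs.
From HB Require Import structures.
From mathcomp Require Import all_boot all_order all_algebra.
From mathcomp Require Import all_classical all_reals all_analysis.
From mathcomp Require Import lra.
Set Implicit Arguments.
Unset Strict Implicit.
Unset Printing Implicit Defensive.

Import Order.TTheory GRing.Theory Num.Theory.
Import numFieldNormedType.Exports.
Local Open Scope classical_set_scope.
Local Open Scope ring_scope.

(** * Averaging, Euclidean distances and a function of class L *)

Lemma sum_pigeonhole (R : realType) (a : nat -> R) (L : nat) (C : R) :
  (0 < L)%N -> \sum_(0 <= k < L) a k <= C ->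
  exists2 k, (k < L)%N & a k <= C / L%:R.
Proof.
move=> L0 hC; apply: contrapT => h.
have hlt k : (k < L)%N -> C / L%:R < a k.
  by move=> kL; rewrite ltNge; apply/negP => hk; apply: h; exists k.
have : \sum_(0 <= k < L) C / L%:R < \sum_(0 <= k < L) a k.
  rewrite !big_mkord; apply: ltr_sum => [|i _]; last exact: hlt.
  by apply/hasP; exists (Ordinal L0); rewrite ?mem_index_enum.
rewrite sumr_const_nat subn0 -[_ *+ L]mulr_natr divfK ?pnatr_eq0 -?lt0n //.
by rewrite ltNge hC.
Qed.

Lemma eucl_dist_ge0 (R : realType) (n : nat) (v w : 'rV[R]_n) :
  0 <= eucl_dist v w.
Proof. exact: sqrtr_ge0. Qed.

Lemma eucl_dist_sqr (R : realType) (n : nat) (v w : 'rV[R]_n) :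
  eucl_dist v w ^+ 2 = \sum_i (v 0 i - w 0 i) ^+ 2.
Proof.
rewrite sqr_sqrtr; last by apply: sumr_ge0 => i _; exact: sqr_ge0.
by apply: eq_bigr => i _; rewrite !mxE.
Qed.

(** Working with squares reduces this to the coordinatewise $(a+b)^2 \le 2a^2+2b^2$, without
    Cauchy-Schwarz. *)
Lemma eucl_dist_sqr_triangle (R : realType) (n : nat) (u v w : 'rV[R]_n) :
  eucl_dist u w ^+ 2 <= 2 * eucl_dist u v ^+ 2 + 2 * eucl_dist v w ^+ 2.
Proof.
rewrite !eucl_dist_sqr !mulr_sumr -big_split; apply: ler_sum => i _ /=.
have := sqr_ge0 ((u 0 i - v 0 i) - (v 0 i - w 0 i)).
rewrite -subr_ge0 => h; rewrite -subr_ge0; move: h; congr (0 <= _).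
by rewrite !expr2; lra.
Qed.

Lemma ref_dist_sqr (R : realType) (n m : nat) (r s : reference R n m) :
  ref_dist r s ^+ 2 = eucl_dist r.1 s.1 ^+ 2 + eucl_dist r.2 s.2 ^+ 2.
Proof. by rewrite sqr_sqrtr // addr_ge0 ?sqr_ge0. Qed.

Lemma ref_dist_ge0 (R : realType) (n m : nat) (r s : reference R n m) :
  0 <= ref_dist r s.
Proof. exact: sqrtr_ge0. Qed.

Lemma ref_distC (R : realType) (n m : nat) (r s : reference R n m) :
  ref_dist r s = ref_dist s r.
Proof.
apply/eqP; rewrite -(@eqrXn2 _ 2) ?ref_dist_ge0 // !ref_dist_sqr !eucl_dist_sqr.
by apply/eqP; congr (_ + _); apply: eq_bigr => i _; rewrite -sqrrN opprB.
Qed.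

Lemma eucl_dist_le_ref_dist (R : realType) (n m : nat) (r s : reference R n m) :
  eucl_dist r.1 s.1 <= ref_dist r s.
Proof.
rewrite -(@ler_pXn2r _ 2) ?nnegrE ?ref_dist_ge0 ?eucl_dist_ge0 //.
by rewrite ref_dist_sqr lerDl sqr_ge0.
Qed.

(** Compactness bounds the sup norm of both components, hence every coordinate; summing over the
    coordinates gives the Euclidean bound. *)
Lemma compact_ref_dist_bounded (R : realType) (n m : nat)
    (A : set (reference R n m)) (s : reference R n m) :
  compact A -> exists2 D, 0 < D & forall r, A r -> ref_dist r s <= D.
Proof.
move=> cA.
have bnd k (h : reference R n m -> 'rV[R]_k) (w : 'rV[R]_k) : continuous h ->
    exists2 D, 0 < D & forall r, A r -> eucl_dist (h r) w ^+ 2 <= D.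
  move=> ch; have : compact (h @` A).
    by apply: continuous_compact => //; exact: continuous_subspaceT.
  move=> /compact_bounded[M0 [_ hM]].
  pose M := M0 + 1; have {}hM x : (h @` A) x -> `|x| <= M.
    by apply: hM; rewrite ltrDl.
  (* From $(a-b)^2 \le 2a^2+2b^2$ in each coordinate; the final 1 makes the bound positive. *)
  exists (\sum_i (M ^+ 2 *+ 2 + w 0 i ^+ 2 *+ 2) + 1).
    apply: ltr_wpDl => //; apply: sumr_ge0 => i _.
    by rewrite addr_ge0 // mulrn_wge0 // sqr_ge0.
  move=> r Ar; rewrite eucl_dist_sqr; apply: ler_wpDr => //.
  apply: ler_sum => i _.
  have hi : `|h r 0 i| <= M.
    apply: le_trans (hM _ _); last by exists r.
    rewrite [leRHS]mx_normrE.
    exact: (le_bigmax _ (fun ij : 'I_1 * 'I_k => `|h r ij.1 ij.2|) (ord0, i)).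
  have : h r 0 i ^+ 2 <= M ^+ 2.
    by rewrite -[leLHS]real_normK ?num_real // lerXn2r // nnegrE ?(le_trans _ hi).
  have := sqr_ge0 (h r 0 i + w 0 i).
  by rewrite !expr2 !mulr2n; lra.
have [|D1 D10 hD1] := @bnd n fst s.1; first by move=> r; exact: cvg_fst.
have [|D2 D20 hD2] := @bnd m snd s.2; first by move=> r; exact: cvg_snd.
exists (Num.sqrt (D1 + D2)) => [|r Ar].
  by rewrite sqrtr_gt0 addr_gt0.
by rewrite /ref_dist ler_wsqrtr // lerD ?hD1 ?hD2.
Qed.

(** Shape of both error terms. The shift by 1 gives continuity and strict decrease from [t = 0]
    on. *)
Lemma class_L_inv (R : realType) (A : R) : 0 < A ->
  class_L (fun t : R => A / (1 + t)).
Proof.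
move=> A0; split.
- apply: continuous_in_subspaceT => t /set_mem /=; rewrite in_itv /= andbT => t0.
  apply: cvgM; first exact: cvg_cst.
  apply: cvgV; first by rewrite gt_eqF //; lra.
  by apply: cvgD; [exact: cvg_cst|exact: cvg_id].
- move=> s t s0 st; rewrite ltr_pM2l // ltf_pV2 ?posrE; lra.
- by move=> t t0; rewrite divr_ge0 //; lra.
- rewrite -[X in _ --> X](mulr0 A); apply: cvgM; first exact: cvg_cst.
  apply: (iffRL (@gtr0_cvgV0 _ _ _ _ _ _)).
    by near=> t; have : 0 < t by []; lra.
  exact: cvg_addrl.
Unshelve. all: end_near. Qed.

(** * Concatenated inputs and the terminal law *)

Section Trajectories.
Variables (R : realType) (n m : nat) (P : mpc_problem R n m).
Implicit Types (x y : 'rV[R]_n) (u v : nat -> 'rV[R]_m) (r : reference R n m).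

Definition cat_input (k : nat) u v : nat -> 'rV[R]_m :=
  fun i => if (i < k)%N then u i else v (i - k)%N.

Lemma solution_catl k u v x i : (i <= k)%N ->
  solution P (cat_input k u v) x i = solution P u x i.
Proof.
elim: i => //= i IH ik; rewrite IH; last exact: ltnW.
by rewrite /cat_input ik.
Qed.

Lemma solution_catr k u v x i :
  solution P (cat_input k u v) x (k + i) = solution P v (solution P u x k) i.
Proof.
elim: i => [|i IH]; first by rewrite addn0 solution_catl.
by rewrite addnS /= IH /cat_input ltnNge leq_addr /= addKn.
Qed.

Lemma solution_behead u x k :
  solution P (fun i => u i.+1) (dyn P x (u 0%N)) k = solution P u x k.+1.
Proof. by elim: k => //= k ->. Qed.

Lemma run_cost_cat r k l u v x :
  run_cost P r (k + l) x (cat_input k u v) =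
  run_cost P r k x u + run_cost P r l (solution P u x k) v.
Proof.
rewrite /run_cost (@big_cat_nat _ _ _ k) //=; last exact: leq_addr.
congr (_ + _).
  apply: eq_big_nat => i /andP[_ ik].
  by rewrite solution_catl 1?ltnW // /cat_input ik.
rewrite -{1}[k]add0n big_addn addKn; apply: eq_big_nat => i _.
by rewrite addnC solution_catr /cat_input ltnNge leq_addr /= addKn.
Qed.

(** The part of [admissible] that passes to prefixes and concatenations; the rest follows from
    [Zsub] and the target set, see [admissible_toP]. *)
Definition feasible_run (k : nat) x u : Prop :=
  forall i, (i < k)%N -> Zset P (solution P u x i, u i).

Lemma feasible_run_cat k l x u v :
  feasible_run k x u -> feasible_run l (solution P u x k) v ->
  feasible_run (k + l) x (cat_input k u v).
Proof.
move=> hu hv i ikl; case: (ltnP i k) => ik.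
  by rewrite solution_catl 1?ltnW // /cat_input ik; exact: hu.
rewrite -(subnKC ik) solution_catr /cat_input ltnNge leq_addr /= addKn.
by apply: hv; rewrite ltn_subLR.
Qed.

Hypothesis Zsub : Zset P `<=` Xset P `*` Uset P.

Lemma admissible_toP k (A : set 'rV[R]_n) x u : A `<=` Xset P ->
  admissible_to P k A x u <->
  feasible_run k x u /\ A (solution P u x k).
Proof.
move=> AX; split=> [[[_ hz _] hA]|[hz hA]]; split=> //; split=> //.
- by move=> i /hz /Zsub[].
- exact: AX.
Qed.

Lemma admissible_feasible k x u : admissible P k x u -> feasible_run k x u.
Proof. by case. Qed.

Section Terminal.
Variables (kf : 'rV[R]_n -> reference R n m -> 'rV[R]_m) (r : reference R n m).
Hypothesis XtermX : Xterm P r `<=` Xset P.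
Hypothesis law : forall x, Xterm P r x ->
  [/\ Xterm P r (dyn P x (kf x r)),
      Vterm P (dyn P x (kf x r)) r - Vterm P x r <= - stage P x (kf x r) r &
      Zset P (x, kf x r)].

(** The terminal feedback unrolled into an open-loop sequence, so that it can be concatenated with
    other inputs. *)
Definition terminal_input x : nat -> 'rV[R]_m :=
  fun i => kf (closed_loop P (kf^~ r) x i) r.

Lemma solution_terminal_input x k :
  solution P (terminal_input x) x k = closed_loop P (kf^~ r) x k.
Proof. by elim: k => //= k ->. Qed.

Lemma terminal_inputE x k :
  terminal_input x k = kf (solution P (terminal_input x) x k) r.
Proof. by rewrite solution_terminal_input. Qed.

Lemma terminal_invariant x k :
  Xterm P r x -> Xterm P r (solution P (terminal_input x) x k).
Proof.
move=> hx; elim: k => //= k /law[+ _ _].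
by rewrite -terminal_inputE.
Qed.

Lemma terminal_feasible x k :
  Xterm P r x -> feasible_run k x (terminal_input x).
Proof.
move=> hx i _; have [_ _] := law (terminal_invariant i hx).
by rewrite -terminal_inputE.
Qed.

(** By the decrease condition on the terminal cost, one more step of the terminal law never raises
    [Jtc], which starts at [Vterm P x r]. *)
Lemma terminal_Jtc x k :
  Xterm P r x -> Jtc P k x (terminal_input x) r <= Vterm P x r.
Proof.
move=> hx; rewrite /Jtc /run_cost; elim: k => [|k IH].
  by rewrite big_geq // add0r.
rewrite big_nat_recr //=; have [_ + _] := law (terminal_invariant k hx).
by rewrite -terminal_inputE; lra.
Qed.

(** The terminal law costs at most the terminal cost at the switching state, which [Jtc P k x u r]
    already contains. *)
Lemma extend_by_terminal_law k N x u : (k <= N)%N ->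
  feasible_run k x u -> Xterm P r (solution P u x k) ->
  exists2 w, admissible_to P N (Xterm P r) x w & Jtc P N x w r <= Jtc P k x u r.
Proof.
move=> kN hu hX; set y := solution P u x k in hX.
exists (cat_input k u (terminal_input y)).
  apply/admissible_toP => //; rewrite -(subnKC kN) solution_catr; split.
    by apply: feasible_run_cat => //; exact: terminal_feasible.
  exact: terminal_invariant.
rewrite -{1}(subnKC kN) /Jtc run_cost_cat -addrA lerD2l solution_catr.
exact: terminal_Jtc.
Qed.

End Terminal.
End Trajectories.

(** * Cost bounds and approach to a fixed reference *)

Section ValueBound.
Variables (R : realType) (n m : nat) (P : mpc_problem R n m).
Variable rd : reference R n m.
Hypothesis Hst : standing_assumptions P rd.
Variables (c1 cb cf : R) (kf : 'rV[R]_n -> reference R n m -> 'rV[R]_m).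
Hypotheses (c1_gt0 : 0 < c1) (cb_gt0 : 0 < cb) (cf_gt0 : 0 < cf).
Hypothesis stage_min_ge : forall x u r, Zset P (x, u) -> refs P r ->
  c1 * eucl_dist x r.1 ^+ 2 <= stage_min P x r.
Hypothesis ball_sub : forall r, refs P r -> eucl_ball cb r.1 `<=` Xterm P r.
Hypothesis law : forall r x, refs P r -> Xterm P r x ->
  [/\ Xterm P r (dyn P x (kf x r)),
      Vterm P (dyn P x (kf x r)) r - Vterm P x r <= - stage P x (kf x r) r,
      Zset P (x, kf x r) &
      Vterm P x r <= cf * stage_min P x r].

Let Zsub := Zset_sub Hst.

Let law3 r (hr : refs P r) x (hx : Xterm P r x) :
  [/\ Xterm P r (dyn P x (kf x r)),
      Vterm P (dyn P x (kf x r)) r - Vterm P x r <= - stage P x (kf x r) r &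
      Zset P (x, kf x r)].
Proof. by have [] := law hr hx. Qed.

Lemma stage_min_le x u r :
  Zset P (x, u) -> refs P r -> stage_min P x r <= stage P x u r.
Proof.
move=> hz hr; apply: ge_inf.
  exists 0 => _ [v [Uv /Zsub[Xx _]] <-].
  exact: (stage_ge0 Hst).
by exists u => //; split=> //; have [] := Zsub hz.
Qed.

Lemma dist_sqr_le_stage x u r :
  Zset P (x, u) -> refs P r -> c1 * eucl_dist x r.1 ^+ 2 <= stage P x u r.
Proof.
by move=> hz hr; apply: le_trans (stage_min_ge hz hr) (stage_min_le hz hr).
Qed.

Lemma stage_feasible_ge0 x u r :
  Zset P (x, u) -> refs P r -> 0 <= stage P x u r.
Proof. by move=> /Zsub[Xx Ux] hr; exact: (stage_ge0 Hst). Qed.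

Lemma Vterm_le_stage x u r : Zset P (x, u) -> refs P r -> Xterm P r x ->
  Vterm P x r <= cf * stage P x u r.
Proof.
move=> hz hr hx; have [_ _ _ /le_trans] := law hr hx; apply.
by rewrite ler_pM2l // stage_min_le.
Qed.

(** The terminal cost is at most [cf] times the stage cost of the terminal law, so a bound on the
    stage cost serves both. *)
Lemma stage_Vterm_bounded : exists2 M, 0 <= M &
  (forall x u r, Zset P (x, u) -> refs P r -> stage P x u r <= M) /\
  (forall x r, refs P r -> Xterm P r x -> Vterm P x r <= cf * M).
Proof.
have [M0 hM0] := stage_bounded Hst; exists (Num.max M0 0).
  by rewrite le_max lexx orbT.
have hM x u r : Zset P (x, u) -> refs P r -> stage P x u r <= Num.max M0 0.
  by move=> hz hr; rewrite le_max hM0.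
split=> // x r hr hx; have [_ _ hz _] := law hr hx.
by apply: le_trans (Vterm_le_stage hz hr hx) _; rewrite ler_pM2l // hM.
Qed.

(** The stage costs along the terminal law sum to at most [cf * M] over any horizon, so one of the
    first [L] is at most [cf * M / L]. The choice of [L] puts this below [c1 * e], and (ii) turns a
    small cost into a small distance. *)
Lemma terminal_approach (e : R) : 0 < e -> exists N1, forall r x,
  refs P r -> Xterm P r x -> exists k u, [/\ (k <= N1)%N, feasible_run P k x u,
    Xterm P r (solution P u x k) &
    eucl_dist (solution P u x k) r.1 ^+ 2 <= e].
Proof.
move=> e0; have [M M0 [_ hV]] := stage_Vterm_bounded.
pose L := (Num.truncn (cf * M / (c1 * e))).+1; exists L => r x hr hx.
have hu : feasible_run P L x (terminal_input P kf r x).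
  by apply: (terminal_feasible (law3 hr)).
have : run_cost P r L x (terminal_input P kf r x) <= cf * M.
  apply: le_trans (hV _ _ hr hx).
  apply: le_trans (terminal_Jtc (law3 hr) L hx).
  by rewrite lerDl (Vterm_ge0 Hst) //; apply: (Xterm_sub Hst hr);
     exact: (terminal_invariant (law3 hr)).
move=> /(sum_pigeonhole (ltn0Sn _))[k kL hk].
exists k, (terminal_input P kf r x); split.
- exact: ltnW.
- by move=> i ik; apply: hu; exact: ltn_trans ik kL.
- exact: (terminal_invariant (law3 hr)).
rewrite -(ler_pM2l c1_gt0).
apply: le_trans (dist_sqr_le_stage (hu k kL) hr) (le_trans hk _).
rewrite ler_pdivrMr ?ltr0n // -ler_pdivrMl ?mulr_gt0 // mulrC.
by rewrite ltW // truncnS_gt.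
Qed.

Lemma XNstd_extend k N x u : (k <= N)%N -> feasible_run P k x u ->
  Xterm P rd (solution P u x k) ->
  exists2 w, admissible_to P N (Xterm P rd) x w & Jtc P N x w rd <= Jtc P k x u rd.
Proof.
have hrd := rd_ref Hst.
exact: (extend_by_terminal_law Zsub (Xterm_sub Hst hrd) (law3 hrd)).
Qed.

Lemma XNstd_prefix k j N x u : (k + j <= N)%N -> feasible_run P k x u ->
  XNstd P rd j (solution P u x k) -> XNstd P rd N x.
Proof.
have XX := Xterm_sub Hst (rd_ref Hst).
move=> kjN hu [v /(admissible_toP Zsub _ _ _ XX)[hv hX]].
have [|w hw _] := XNstd_extend kjN (feasible_run_cat hu hv).
  by rewrite solution_catr.
by exists w.
Qed.

(** * Moving the reference to the best reachable one *)

Variables (c1r c2r : R).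
Hypotheses (c1r_gt0 : 0 < c1r) (c2r_gt0 : 0 < c2r).
Hypothesis improve : forall r (theta : R), refs P r -> 0 <= theta <= 1 ->
  exists rhat, [/\ refs P rhat,
    ref_dist rhat r <= c1r * theta * ref_dist r rd &
    offset P rhat - offset P r <= - (c2r * theta * ref_dist r rd ^+ 2)].

(** The radius [cb / 2] is what the factors 2 of [eucl_dist_sqr_triangle] allow: $4(c_b/2)^2 =
    c_b^2$. *)
Lemma eucl_ball_near r s y : refs P s ->
  eucl_dist y r.1 ^+ 2 <= (cb / 2) ^+ 2 -> ref_dist r s ^+ 2 <= (cb / 2) ^+ 2 ->
  Xterm P s y.
Proof.
move=> hs hy hrs; apply: (ball_sub hs); rewrite /eucl_ball /=.
rewrite -(@ler_pXn2r _ 2) ?nnegrE ?eucl_dist_ge0 ?(ltW cb_gt0) //.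
apply: le_trans (eucl_dist_sqr_triangle _ r.1 _) _.
have : eucl_dist r.1 s.1 ^+ 2 <= (cb / 2) ^+ 2.
  by apply: le_trans hrs; rewrite ref_dist_sqr lerDl sqr_ge0.
by move: hy; rewrite !expr2; lra.
Qed.

(* Each round costs at most [N1] steps and either ends in the terminal set of
   [rd] or lowers the offset of the tracked reference by [d]. *)
Lemma reach_rd_of_offset : exists N1 d, 0 < d /\ forall j r x,
  refs P r -> Xterm P r x -> offset P r <= j%:R * d ->
  XNstd P rd (j.+1 * N1) x.
Proof.
have hrd := rd_ref Hst; have XX := Xterm_sub Hst hrd.
have [D D0 hD] := compact_ref_dist_bounded rd (Zset_compact Hst).
have refsZ r : refs P r -> Zset P r.
  by move=> [/(Zref_sub Hst) /interior_subset].
pose e := cb / 2; have e0 : 0 < e by rewrite divr_gt0.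
have [N1 hN1] := @terminal_approach (e ^+ 2) (exprn_gt0 _ e0).
(* Chosen so that [c1r * theta * D <= e]: the new reference stays within [e] of the old one. The [e]
   in the denominator ensures [theta <= 1]. *)
pose theta := e / (c1r * D + e).
have cD0 : 0 < c1r * D by rewrite mulr_gt0.
have theta0 : 0 < theta by rewrite divr_gt0 ?addr_gt0.
have arrive k u x : feasible_run P k x u ->
    Xterm P rd (solution P u x k) -> XNstd P rd k x.
  by move=> hu hX; exists u; apply/admissible_toP.
have thetaP : 0 <= theta <= 1.
  by rewrite ltW //= ler_pdivrMr ?addr_gt0 // mul1r lerDr ltW.
have d0 : 0 < c2r * theta * e ^+ 2.
  by apply: mulr_gt0 (exprn_gt0 _ e0); exact: mulr_gt0.
exists N1, (c2r * theta * e ^+ 2); split=> //.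
(* Induction on the offset measured in units of the guaranteed drop $d = c_2^r \theta e^2$. *)
elim=> [|j IH] r x hr hx hT; have [k [u [kN hu hX hd]]] := hN1 r x hr hx;
  set y := solution P u x k in hX hd;
  have [near|far] := leP (ref_dist r rd ^+ 2) (e ^+ 2).
(* Reference close to [rd]: the state reached already lies in the terminal set of [rd]. *)
1,3: have y_rd := eucl_ball_near hrd hd near;
  apply: (@XNstd_prefix k 0 _ _ u _ hu);
    [by rewrite addn0 mulSn (leq_trans kN) ?leq_addr|by apply: (arrive 0%N u)].
(* Otherwise (vii) gives a reference whose offset is lower by at least [d]. *)
all: have [s [hs sr sT]] := improve hr thetaP.
all: have sT' : offset P s <= offset P r - c2r * theta * e ^+ 2
    by rewrite -lerBlDl; apply: le_trans sT _; rewrite lerN2 ler_pM2l;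
      [exact: ltW|exact: mulr_gt0].
(* Here the offset was at most 0, so the drop would bring it below its minimum 0. *)
- have := rd_argmin Hst hs; rewrite (rd_offset Hst) leNgt => /negP[].
  apply: le_lt_trans sT' _; rewrite mul0r in hT.
  by rewrite subr_lt0 (le_lt_trans hT).
(* Both the state and [s] are within [e] of [r], so tracking can switch from [r] to [s]. *)
- have hsy : Xterm P s y.
    apply: (eucl_ball_near hs hd); rewrite ref_distC
      lerXn2r ?nnegrE ?ref_dist_ge0 ?(ltW e0) //.
    apply: le_trans sr _; apply: (@le_trans _ _ (c1r * theta * D)).
      by apply: ler_wpM2l; [exact: ltW (mulr_gt0 _ _)|exact: hD (refsZ _ hr)].
    rewrite mulrAC /theta mulrA ler_pdivrMr ?addr_gt0 // mulrC ler_pM2l //.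
    by rewrite lerDl ltW.
  apply: (@XNstd_prefix k (j.+1 * N1) _ _ u _ hu).
    by rewrite [leqRHS]mulSn leq_add2r.
  apply: (IH s) => //; apply: le_trans sT' _.
  by rewrite lerBlDr (le_trans hT) // -natr1 mulrDl mul1r.
Qed.

(** The upper bound in (i) and the boundedness of the references bound the offset by [a D], so one
    number of rounds serves all references. *)
Lemma reach_rd (a : R -> R) : class_Kinfty a ->
  (forall r, refs P r -> offset P r <= a (ref_dist r rd)) ->
  exists k, forall r x, refs P r -> Xterm P r x -> XNstd P rd k x.
Proof.
move=> Ka ha; have [N1 [d [d0 hreach]]] := reach_rd_of_offset.
have [D D0 hD] := compact_ref_dist_bounded rd (Zset_compact Hst).
pose j := (Num.truncn (a D / d)).+1; exists (j.+1 * N1)%N => r x hr hx.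
apply: (hreach j r x hr hx); apply: le_trans (ha r hr) _.
have rD : ref_dist r rd <= D.
  by apply: hD; move: hr => [/(Zref_sub Hst) /interior_subset].
apply: (@le_trans _ _ (a D)).
  move: rD; rewrite le_eqVlt => /predU1P[->//|rD].
  exact: ltW (Kinfty_incr Ka (ref_dist_ge0 _ _) rD).
by rewrite -ler_pdivrMr // ltW // truncnS_gt.
Qed.

Lemma std_value_bound (a : R -> R) (Ntilde : nat) : class_Kinfty a ->
  (forall r, refs P r -> offset P r <= a (ref_dist r rd)) ->
  exists Nbar C, [/\ (0 < Nbar)%N, 0 < C & forall N x, (Nbar <= N)%N ->
    XN P Ntilde x ->
    exists2 u, admissible_to P N (Xterm P rd) x u & Jtc P N x u rd <= C].
Proof.
move=> Ka ha; have [k hk] := reach_rd Ka ha.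
have [M M0 [hM hV]] := stage_Vterm_bounded.
have hrd := rd_ref Hst; have XX := Xterm_sub Hst hrd.
(* [Ntilde] steps to some terminal set and [k] more to that of [rd], each costing at most [M], plus
   a terminal cost of at most [cf * M]; the 1 makes the bound positive. *)
pose L := (Ntilde + k)%N; exists L.+1, (L%:R * M + cf * M + 1); split=> //.
  by rewrite ltr_wpDl // addr_ge0 ?mulr_ge0 // ltW.
move=> N x LN [[u r] [/= hr /(admissible_toP Zsub _ _ _ (Xterm_sub Hst hr))[hu hX]]].
have [v /(admissible_toP Zsub _ _ _ XX)[hv hvX]] :=
  XNstd_prefix (leqnn _) hu (hk _ _ hr hX).
have [w hw hJ] := XNstd_extend (ltnW LN) hv hvX.
exists w => //; apply: le_trans hJ _; apply: ler_wpDr => //.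
apply: lerD; last exact: hV.
rewrite /run_cost mulr_natl -[X in _ *+ X](subn0 L) -sumr_const_nat.
by apply: ler_sum_nat => i iL; apply: hM => //; exact: hv.
Qed.

(** [V] stands for the tracking value at [x]. A cheap run must pass close to $x_d$, and stopping it
    there gives a competitor whose only extra cost is a small terminal cost. *)
Lemma turnpike (C : R) : 0 < C -> exists2 A, 0 < A &
  forall (V : R) (N K : nat) x u,
    V <= C ->
    (forall k w, (k <= N)%N -> feasible_run P k x w ->
       Xterm P rd (solution P w x k) -> V <= Jtc P k x w rd) ->
    feasible_run P K x u ->
    V <= run_cost P rd K x u + A / (1 + N%:R) + A / (1 + K%:R).
Proof.
move=> C0; have hrd := rd_ref Hst.
(* A stage cost of at most [b] forces the state into the ball of radius [cb], hence into the
   terminal set of [rd]. In [A], the first summand pays for the terminal cost and the second for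
   short horizons. *)
pose b := c1 * cb ^+ 2; have b0 : 0 < b by rewrite mulr_gt0 ?exprn_gt0.
pose A := 2 * (cf * C) + C * (C / b + 1).
have CfC : 0 < cf * C by rewrite mulr_gt0.
have A0 : 0 < A by rewrite addr_gt0 ?mulr_gt0 ?addr_gt0 ?divr_gt0.
exists A => // V N K x u VC hV hu.
have pos (q : nat) : 0 < 1 + q%:R :> R by rewrite ltr_wpDr.
have posA q : 0 < A / (1 + q%:R) by rewrite divr_gt0.
have run_ge0 i j : (j <= K)%N ->
    0 <= \sum_(i <= l < j) stage P (solution P u x l) (u l) rd.
  move=> jK; rewrite big_nat_cond; apply: sumr_ge0 => l /andP[/andP[_ lj] _].
  by apply: stage_feasible_ge0 => //; apply: hu; exact: leq_trans jK.
have J0 : 0 <= run_cost P rd K x u by exact: run_ge0.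
suff [L hL hLV] : exists2 L : nat, (L = N \/ L = K) &
    V <= run_cost P rd K x u + A / (1 + L%:R).
  case: hL hLV => -> h; first exact: le_trans h (ler_wpDr (ltW (posA K)) (lexx _)).
  by apply: le_trans h _; rewrite lerD2r lerDl ltW.
pose L := minn N K; exists L; first by rewrite /L /minn; case: ifP; [left|right].
have [JC|JC] := leP C (run_cost P rd K x u).
  by rewrite (le_trans VC) // (le_trans JC) // lerDl ltW.
(* For [L <= C / b] the error term alone exceeds [C], which bounds [V]. *)
have [Lsmall|Llarge] := leP (b * L%:R) C.
  apply: (le_trans VC); apply: ler_wpDl => //; rewrite ler_pdivlMr //.
  have : L%:R <= C / b by rewrite ler_pdivlMr // mulrC.
  move=> h; apply: (@le_trans _ _ (C * (C / b + 1))).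
    by rewrite ler_pM2l // addrC lerD2r.
  by rewrite lerDr ltW // mulr_gt0.
have L0 : (0 < L)%N.
  rewrite lt0n; apply/eqP => L0; move: Llarge; rewrite L0 mulr0.
  by rewrite ltNge ltW.
have LR0 : 0 < L%:R :> R by rewrite ltr0n.
have LK : (L <= K)%N := geq_minr _ _.
have LN : (L <= N)%N := geq_minl _ _.
have [|k kL hk] := @sum_pigeonhole _
  (fun l => stage P (solution P u x l) (u l) rd) L C L0.
  apply: le_trans (ltW JC); rewrite /run_cost [leRHS](@big_cat_nat _ _ _ L) //=.
  by rewrite lerDl run_ge0.
have kK : (k < K)%N := leq_trans kL LK.
have hz := hu k kK.
have hX : Xterm P rd (solution P u x k).
  apply: (ball_sub hrd); rewrite /eucl_ball /=.
  rewrite -(@ler_pXn2r _ 2) ?nnegrE ?eucl_dist_ge0 ?(ltW cb_gt0) //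
    -(ler_pM2l c1_gt0).
  apply: le_trans (dist_sqr_le_stage hz hrd) (le_trans hk _).
  by rewrite ler_pdivrMr // ltW.
have huk : feasible_run P k x u by move=> i ik; apply: hu; exact: ltn_trans kK.
apply: le_trans (hV k u (ltnW (leq_trans kL LN)) huk hX) _; apply: lerD.
  rewrite /run_cost [leRHS](@big_cat_nat _ _ _ k) ?(ltnW kK) //=.
  by rewrite lerDl run_ge0.
apply: le_trans (Vterm_le_stage hz hrd hX) _.
apply: (@le_trans _ _ (cf * (C / L%:R))); first by rewrite ler_pM2l.
rewrite mulrA ler_pdivrMr // mulrAC ler_pdivlMr //.
(* As [L >= 1], [1 + L <= 2 * L]; this is the factor 2 in [A]. *)
apply: (@le_trans _ _ (2 * (cf * C) * L%:R)); last first.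
  by rewrite ler_pM2r // lerDl ltW // mulr_gt0 // addr_gt0 // divr_gt0.
have : cf * C * 1 <= cf * C * L%:R by rewrite ler_pM2l // ler1n.
lra.
Qed.
End ValueBound.

(** * Decrease of the value along the closed loop *)

Section ClosedLoop.
Variables (R : realType) (n m : nat) (P : mpc_problem R n m).
Variables (kf : 'rV[R]_n -> reference R n m -> 'rV[R]_m).
Hypothesis Zsub : Zset P `<=` Xset P `*` Uset P.
Hypothesis XtermX : forall r, refs P r -> Xterm P r `<=` Xset P.
Hypothesis law : forall r x, refs P r -> Xterm P r x ->
  [/\ Xterm P r (dyn P x (kf x r)),
      Vterm P (dyn P x (kf x r)) r - Vterm P x r <= - stage P x (kf x r) r &
      Zset P (x, kf x r)].

Lemma VN_optimal N x ur :
  track_optimal P N x ur -> VN P N x = (track_cost P N x ur)%:E.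
Proof.
move=> [hc hopt]; apply/eqP; rewrite eq_le; apply/andP; split.
  by apply: ge_ereal_inf; exists (track_cost P N x ur)%:E => //; exists ur.
by apply: le_ereal_inf_tmp => _ [ur' hc' <-]; rewrite lee_fin; exact: hopt.
Qed.

(** The tail of [ur.1] is one step short; [extend_by_terminal_law] fills the horizon at no extra
    cost. The reference is kept, so the offset terms cancel. *)
Lemma VN_step N x ur : (0 < N)%N -> track_candidates P N x ur ->
  exists2 ur', track_candidates P N (dyn P x (ur.1 0%N)) ur' &
    track_cost P N (dyn P x (ur.1 0%N)) ur' <=
      track_cost P N x ur - stage P x (ur.1 0%N) ur.2.
Proof.
case: N ur => // N [u r] _ [/= hr /(admissible_toP Zsub _ _ _ (XtermX hr))[hu hX]].
have [||w hw hJ] := extend_by_terminal_law Zsub (XtermX hr) (fun x => law hr)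
  (leqnSn N) (x := dyn P x (u 0%N)) (u := fun i => u i.+1).
- by move=> i iN; rewrite solution_behead; exact: hu.
- by rewrite solution_behead.
exists (w, r); first by split.
rewrite /track_cost /= [leRHS]addrAC lerD2r (le_trans hJ) //.
rewrite /Jtc /run_cost solution_behead big_nat_recl //= [leRHS]addrC !addrA
  addNr add0r.
by rewrite lerD2r; apply: ler_sum => i _; rewrite solution_behead.
Qed.

Variables (ustar : nat -> 'rV[R]_n -> nat -> 'rV[R]_m)
  (rstar : nat -> 'rV[R]_n -> reference R n m).
Hypothesis Htrack : forall N x, XN P N x ->
  track_optimal P N x (ustar N x, rstar N x).

(** The decrease telescopes. Feasibility is carried through the induction because optimality of
    [ustar] and [rstar] is available only on [XN P N]. *)
Lemma closed_loop_cost N x : (0 < N)%N -> XN P N x -> forall K,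
  let xmu := closed_loop P (fun y => ustar N y 0%N) x in
  let V y := track_cost P N y (ustar N y, rstar N y) in
  XN P N (xmu K) /\
  \sum_(0 <= k < K) stage P (xmu k) (ustar N (xmu k) 0%N) (rstar N (xmu k))
    <= V x - V (xmu K).
Proof.
move=> N0 hx K xmu V; elim: K => [|K [hK IH]].
  by rewrite big_geq // subrr; split.
have [hc _] := Htrack hK.
have [ur' hc' hle] := VN_step N0 hc.
have hK' : XN P N (xmu K.+1) by exists ur'.
split=> //; rewrite big_nat_recr //=.
have := (Htrack hK').2 _ hc'; rewrite -/(V _) => hopt.
move: IH (le_trans hopt hle); rewrite -/(V _) /=; lra.
Qed.
End ClosedLoop.

Theorem theorem2 (R : realType) (n m : nat)
  (P : mpc_problem R n m) (rd : reference R n m)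
  (Hst : standing_assumptions P rd)
  (* optimal input sequences and references of the MPC for tracking *)
  (ustar : nat -> 'rV[R]_n -> nat -> 'rV[R]_m)
  (rstar : nat -> 'rV[R]_n -> reference R n m)
  (Htrack : forall N x, XN P N x ->
     track_optimal P N x (ustar N x, rstar N x))
  (* optimal input sequences and stability constants of the standard MPC *)
  (ustd : nat -> 'rV[R]_n -> nat -> 'rV[R]_m)
  (Hstd : forall N x, XNstd P rd N x -> std_optimal P rd N x (ustd N x))
  (cstd gstd : nat -> R)
  (Hcstd : forall N, (0 < N)%N -> 0 < cstd N)
  (Hgstd : forall N, (0 < N)%N -> 0 < gstd N < 1)
  (Hexp : forall N, (0 < N)%N -> forall x, XNstd P rd N x -> forall t : nat,
     eucl_dist (closed_loop P (fun y => ustd N y 0%N) x t) rd.1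
       <= cstd N * eucl_dist x rd.1 * gstd N ^+ t)
  (* (i) *)
  (Hi : exists aT_lo aT_up : R -> R,
     [/\ class_Kinfty aT_lo, class_Kinfty aT_up &
       forall r, refs P r ->
         aT_lo (ref_dist r rd) <= offset P r <= aT_up (ref_dist r rd)])
  (* (ii) *)
  (Hii : exists c1 c2 : R, [/\ 0 < c1, 0 < c2 &
     forall x u r, Zset P (x, u) -> refs P r ->
       c1 * eucl_dist x r.1 ^+ 2 <= stage_min P x r <= c2 * eucl_dist x r.1 ^+ 2])
  (* (iii) *)
  (Hiii : exists c3 c4 : R, [/\ 0 < c3, 0 < c4 &
     forall r1 r2 x u, refs P r1 -> refs P r2 -> Zset P (x, u) ->
       stage P x u r1 <= c3 * stage P x u r2 + c4 * ref_dist r1 r2 ^+ 2])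
  (* (iv) *)
  (c5 c6 : R) (Hc5 : 0 < c5) (Hc6 : 0 < c6)
  (Hiv : forall r1 r2 x u, refs P r1 -> refs P r2 -> Zset P (x, u) ->
     stage P x u r1
       <= stage P x u r2 + c5 * ref_dist r1 r2 ^+ 2 + c6 * ref_dist r1 r2)
  (* (v) *)
  (Hv : exists (cb cf : R) (kf : 'rV[R]_n -> reference R n m -> 'rV[R]_m),
     [/\ 0 < cb, 0 < cf,
       {within Xset P `*` refs P, continuous (fun p => Vterm P p.1 p.2)},
       forall r, refs P r ->
         compact (Xterm P r) /\ eucl_ball cb r.1 `<=` Xterm P r &
       forall r x, refs P r -> Xterm P r x ->
         let xplus := dyn P x (kf x r) in
         [/\ Xterm P r xplus,
             Vterm P xplus r - Vterm P x r <= - stage P x (kf x r) r,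
             Zset P (x, kf x r) &
             Vterm P x r <= cf * stage_min P x r]])
  (* (vi) *)
  (Hvi : (forall N : nat, N%:R <= scaling P N) /\ 1 <= scaling P 0%N)
  (* (vii) *)
  (Hvii : exists c1r c2r : R, [/\ 0 < c1r, 0 < c2r &
     forall r (theta : R), refs P r -> 0 <= theta <= 1 ->
       exists rhat, [/\ refs P rhat,
         ref_dist rhat r <= c1r * theta * ref_dist r rd &
         offset P rhat - offset P r <= - (c2r * theta * ref_dist r rd ^+ 2)]]) :
  forall Ntilde : nat,
  exists (delta1 delta2 : R -> R) (Nbar : nat),
    [/\ class_L delta1, class_L delta2, (0 < Nbar)%N &
      forall x, XN P Ntilde x -> forall N K : nat, (Nbar <= N)%N ->
        let mu := fun y => ustar N y 0%N in
        let xmu := closed_loop P mu x in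
        let kappa := cstd N * eucl_dist x rd.1 * gstd N ^+ K in
        ((\sum_(0 <= k < K) stage P (xmu k) (mu (xmu k)) rd)%:E
         <= ereal_inf [set (run_cost P rd K x u)%:E
                      | u in admissible_to P K (eucl_ball kappa rd.1) x]
            + (delta1 N%:R)%:E + (delta2 K%:R)%:E - VN P N (xmu K)
            + (\sum_(0 <= k < K)
                 (c5 * ref_dist (rstar N (xmu k)) rd ^+ 2
                  + c6 * ref_dist (rstar N (xmu k)) rd))%:E)%E].
Proof.
have [aT_lo [aT_up [_ Kup hT]]] := Hi.
have [c1 [c2 [c1_gt0 _ hmin]]] := Hii.
have [cb [cf [kf [cb_gt0 cf_gt0 _ hterm hlaw]]]] := Hv.
have [c1r [c2r [c1r_gt0 c2r_gt0 himp]]] := Hvii.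
have Zsub := Zset_sub Hst; have XtermX := Xterm_sub Hst; have hrd := rd_ref Hst.
have ball_sub r : refs P r -> eucl_ball cb r.1 `<=` Xterm P r.
  by move=> /hterm[].
have min_ge x u r : Zset P (x, u) -> refs P r ->
    c1 * eucl_dist x r.1 ^+ 2 <= stage_min P x r.
  by move=> hz hr; have /andP[] := hmin x u r hz hr.
have up r : refs P r -> offset P r <= aT_up (ref_dist r rd).
  by move=> /hT/andP[].
have law3 r x : refs P r -> Xterm P r x ->
    [/\ Xterm P r (dyn P x (kf x r)),
        Vterm P (dyn P x (kf x r)) r - Vterm P x r <= - stage P x (kf x r) r &
        Zset P (x, kf x r)].
  by move=> hr hx; have [] := hlaw r x hr hx.
move=> Ntilde.
have [Nbar [C [Nbar0 C0 hC]]] := std_value_bound Hst c1_gt0 cb_gt0 cf_gt0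
  min_ge ball_sub hlaw c1r_gt0 c2r_gt0 himp Ntilde Kup up.
have [A A0 hA] := turnpike Hst c1_gt0 cb_gt0 cf_gt0 min_ge ball_sub hlaw C0.
exists (fun t => A / (1 + t)), (fun t => A / (1 + t)), Nbar.
split; [exact: class_L_inv|exact: class_L_inv|exact: Nbar0|].
move=> x hx N K NN; lazy zeta.
set mu := fun y => ustar N y 0%N; set xmu := closed_loop P mu x.
set kappa := cstd N * _ * _.
(* The offset vanishes at [rd], so every candidate of the standard problem competes in the tracking
   problem at its own cost, whatever the scaling. *)
have rd_cost w : track_cost P N x (w, rd) = Jtc P N x w rd.
  by rewrite /track_cost /= (rd_offset Hst) mulr0 addr0.
have [w0 hw0 hJ0] := hC N x NN hx.
have hxN : XN P N x by exists (w0, rd).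
have N0 : (0 < N)%N := leq_trans Nbar0 NN.
pose V y := track_cost P N y (ustar N y, rstar N y).
have VX w : admissible_to P N (Xterm P rd) x w -> V x <= Jtc P N x w rd.
  have [_ opt] := Htrack _ _ hxN.
  by move=> hw; rewrite -rd_cost; apply: (opt (w, rd)); split.
have VC : V x <= C := le_trans (VX _ hw0) hJ0.
have [hxK hsum] := closed_loop_cost Zsub XtermX law3 Htrack N0 hxN K.
rewrite -/mu -/xmu -/(V _) in hxK hsum.
rewrite (VN_optimal (Htrack _ _ hxK)) -/(V _).
(* A run of at most [N] steps into the terminal set of [rd] extends to a candidate of horizon [N],
   which is the comparison that [turnpike] asks for. *)
have key u : admissible_to P K (eucl_ball kappa rd.1) x u ->
    V x <= run_cost P rd K x u + A / (1 + N%:R) + A / (1 + K%:R).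
  move=> [/admissible_feasible hu _]; apply: hA => // k w kN hw hX.
  have [w' hw' hJ] := extend_by_terminal_law Zsub (XtermX _ hrd)
    (fun x => @law3 rd x hrd) kN hw hX.
  exact: le_trans (VX _ hw') hJ.
have hrefs : \sum_(0 <= k < K) stage P (xmu k) (mu (xmu k)) rd <= V x - V (xmu K) +
    \sum_(0 <= k < K) (c5 * ref_dist (rstar N (xmu k)) rd ^+ 2
                  + c6 * ref_dist (rstar N (xmu k)) rd).
  apply: le_trans (lerD hsum (lexx _)); rewrite -big_split.
  apply: ler_sum => k _ /=.
  (* (iv) passes from the optimal reference to [rd]; it applies since the first pair of the optimal
     trajectory lies in [Zset P]. *)
  have [hxk _] := closed_loop_cost Zsub XtermX law3 Htrack N0 hxN k.
  have [[/= hr [[_ hz _] _]] _] := Htrack _ _ hxk.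
  by rewrite ref_distC addrA; apply: Hiv => //; exact: (hz 0%N N0).
set S := (X in (_ + X%:E)%E); rewrite -/S in hrefs.
set d1 := A / _; set d2 := A / _.
rewrite -EFinN.
set I := ereal_inf _.
have hI : ((V x - d1 - d2)%:E <= I)%E.
  apply: le_ereal_inf_tmp => _ [u hu <-]; rewrite lee_fin.
  by have := key u hu; rewrite -/d1 -/d2; lra.
(* The infimum is [+oo] if no admissible input ends in the ball, and then the bound is trivial; [hI]
   rules out [-oo]. *)
move: I hI => [r| |] hI.
- by rewrite -!EFinD lee_fin; move: hI; rewrite lee_fin; move: hrefs;
     clearbody S d1 d2; lra.
- by rewrite leey.
- by move: hI; rewrite leeNy_eq.
Qed.
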